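(* Let $\lambda\geq 2$ and $r\in(0,1/6)$. If $M$ is a compact and doubling metric space with doubling constant $D>0$ and $(M_k)_{k\in\mathbb{N}}$ is any sequence of $(\lambda,r)$-finite hyperbolic approximations of $M$, then for every $k\in\mathbb{N}$ with $k>\log_{1/r}(\mathrm{diam}(M))$, $$d_1(M_k)\leq sd_1(M_k)\leq 1+2D\lambda^{\log_2 D}.$$
   Context: A metric space is doubling with constant $D$ if for every $R>0$, every ball of radius $R$ can be covered by $D$ balls of radius $R/2$. $B_M(x,R)=\{z\in M:d(z,x)\le R\}$. Hyperbolic approximations. An $\varepsilon$-net of $M$ is a set $N\subset M$ such that $d(x,y)\ge\varepsilon$ for distinct $x,y\in N$ and every $x\in M$ has some $y\in N$ with $d(x,y)\le\varepsilon$. Fix $r^i$-nets $L_i$ of $M$ for $i\in\mathbb{Z}$ (layers). For $k\in\mathbb{N}$, $G_k$ is the graph with vertex set the disjoint union $\bigsqcup_{i=-k}^kL_i$ and the following edges: distinct $x,y\in L_i$ are joined (horizontal edge) iff $B_M(x,\lambda r^i)\cap B_M(y,\lambda r^i)\neq\emptyset$; $x\in L_i$ and $y\in L_{i+1}$ are joined (radial edge) iff $B_M(y,\lambda r^{i+1})\subset B_M(x,\lambda r^i)$. For compact $M$ and $k>\log_{1/r}(\mathrm{diam}(M))$ the graph $G_k$ is finite and connected, and $M_k$ is its vertex set with the graph distance (all edges of length 1). $(M_k)$ is called a sequence of $(\lambda,r)$-finite hyperbolic approximations of $M$ (with layers $(L_i)$). For such $k$ the layer $L_{-k}$ is a single point,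 which is the distinguished point $0$ of $M_k$. Transportation cost spaces. Let $(X,d)$ be a finite metric space with $N+1$ points and distinguished point $0$. $\mathrm{Lip}_0(X)$ is the space of functions $f:X\to\mathbb{R}$ with $f(0)=0$, normed by the least Lipschitz constant; $\mathcal{F}(X)$ is its dual normed space ($\dim\mathcal{F}(X)=N$). Elements of $\mathcal{F}(X)$ are represented by functions $\mu:X\to\mathbb{R}$ acting by $\langle\mu,f\rangle=\sum_x\mu(x)f(x)$; the value $\mu(0)$ is irrelevant; $\delta_x$ is the indicator function of $x$. For a basis $(b_n)_{n=1}^N$ of $\mathcal{F}(X)$ with dual basis $(b_n^* )$, $d_1(b_n)=\max_{\|x\|=1}\sum_n|b_n^*(x)|\,\|b_n\|$. $d_1(X)$ is the Banach–Mazur distance between $\mathcal{F}(X)$ and $\ell_1^N$, equivalently the minimum of $d_1(b_n)$ over all bases. For $S\subset X$ with $0\in S$, identify $\mathcal{F}(S)$ with the span of $\{\delta_x:x\in S\}$; a stochastic retraction onto $S$ is a map $R$ from $X$ to the probability measures on $S$ with $R(x)=\delta_x$ for $x\in S$, and its linear extension $\widehat R:\mathcal{F}(X)\to\mathcal{F}(S)$ is also called a stochastic retraction. A basis is stochastic if all its canonical projections $P_n(x)=\sum_{i\le n}b_i^*(x)b_i$ are stochastic retractions, and $sd_1(X)=\min\{d_1(b_n):(b_n)\text{ stochastic basis of }\mathcal{F}(X)\}$. *)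

(* Defs.v *)
From mathcomp Require Import all_boot all_order all_algebra.
From mathcomp Require Import finmap.
From mathcomp Require Import all_classical all_reals all_analysis.

Set Implicit Arguments.
Unset Strict Implicit.
Unset Printing Implicit Defensive.
Import Order.TTheory GRing.Theory Num.Theory.
Local Open Scope classical_set_scope.
Local Open Scope ring_scope.

Section MetricSpaces.
Variables (R : realType) (M : metricType R).

Definition cball (x : M) (rho : R) : set M := [set z | mdist z x <= rho].

Definition doubling (D : nat) : Prop :=
  forall (x : M) (rho : R), 0 < rho ->
    exists c : 'I_D -> M,
      cball x rho `<=` \bigcup_(i in [set: 'I_D]) cball (c i) (rho / 2).

Definition diam : \bar R :=
  ereal_sup [set (mdist p.1 p.2)%:E | p in [set: M * M]].

Definition is_net (eps : R) (N : set M) : Prop :=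
  (forall x y, N x -> N y -> x <> y -> eps <= mdist x y) /\
  (forall x : M, exists2 y, N y & mdist x y <= eps).

End MetricSpaces.

(* Logarithm to base [b], with [elog b 0 = -oo] when [1 < b]. *)
Definition elog (R : realType) (b : R) (x : \bar R) : \bar R :=
  (lne x * ((ln b)^-1)%:E)%E.

Section HyperbolicApproximation.
Variables (R : realType) (M : metricType R) (lambda r : R) (L : int -> set M).

Definition Gverts (k : nat) : set (int * M) :=
  [set v | - k%:Z <= v.1 <= k%:Z /\ L v.1 v.2].

(* [fset_set] is the empty set on infinite sets; by [finite_Gverts] below this
   never happens for a compact [M]. *)
Definition Gvertex (k : nat) : finType := fset_set (Gverts k).

Definition layer_ball (v : int * M) : set M := cball v.2 (lambda * r ^ v.1).

Definition horizontal (u v : int * M) : Prop :=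
  [/\ u.1 = v.1, u.2 <> v.2 & layer_ball u `&` layer_ball v !=set0].

Definition radial (u v : int * M) : Prop :=
  v.1 = u.1 + 1 /\ layer_ball v `<=` layer_ball u.

Definition Gedge (k : nat) : rel (Gvertex k) := fun u v =>
  `[< [\/ horizontal (val u) (val v), radial (val u) (val v)
        | radial (val v) (val u)] >].

End HyperbolicApproximation.

Section FiniteVertices.
Variables (R : realType) (M : metricType R).

Lemma finite_net (eps : R) (N : set M) :
  0 < eps -> compact [set: M] -> is_net eps N -> finite_set N.
Proof.
move=> e0 /compact_near_coveringP cM [sepN _].
pose up (F0 : {fset M}) := [set F : {fset M} | (F0 `<=` F)%fset].
have upF : Filter (filter_from [set: {fset M}] up).
  apply: filter_fromT_filter; first by exists fset0.
  by move=> A B; exists (A `|` B)%fset => F /=; rewrite /up /= fsubUset => /andP.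
have [x _|F0 _ cF0] := cM {fset M} (filter_from [set: {fset M}] up)
    (fun F x => exists2 c, c \in F & ball c (eps / 2) x) upF.
  exists (ball x (eps / 2), up [fset x]%fset) => /=.
    by split; [apply: nbhsx_ballx; rewrite divr_gt0|exists [fset x]%fset].
  move=> [y F] [/= xy xF]; exists x => //.
  by move/fsubsetP: xF; apply; rewrite inE.
have /choice[g gP] : forall x : M, exists c, c \in F0 /\ ball c (eps / 2) x.
  by move=> x; have [c cF cx] := cF0 F0 (fsubset_refl _) x I; exists c.
have injg : {in N &, injective g}.
  move=> x y /set_mem Nx /set_mem Ny gxy; apply: contrapT => xy.
  have [_ gx] := gP x; have [_ gy] := gP y; rewrite -gxy in gy.
  have := ball_triangle (ball_sym gx) gy.
  by rewrite -splitr ballEmdist /= ltNge (sepN x y Nx Ny xy).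
rewrite -(eq_finite_set (inj_card_eq injg)); apply: sub_finite_set (finite_fset F0).
by move=> _ [x _ <-]; have [] := gP x.
Qed.

Lemma finite_Gverts (r : R) (L : int -> set M) (k : nat) :
  0 < r -> compact [set: M] -> (forall i, is_net (r ^ i) (L i)) ->
  finite_set (Gverts L k).
Proof.
move=> r0 cM netL.
apply: (@sub_finite_set _ _
  (\bigcup_(j in `I_(k + k).+1) ((pair (j%:Z - k%:Z)) @` L (j%:Z - k%:Z)))).
  move=> [i x] [/= /andP[ki ik] Lx].
  have ik0 : 0 <= i + k%:Z by rewrite -lerBlDr sub0r.
  have [j ij] : exists j : nat, i + k%:Z = j%:Z.
    by exists (absz (i + k%:Z)); rewrite gez0_abs.
  have -> : i = j%:Z - k%:Z by rewrite -ij addrK.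
  exists j; last by exists x => //; rewrite -ij addrK.
  by rewrite /= ltnS -lez_nat -ij PoszD lerD2r.
apply: bigcup_finite => [|j _]; first exact: finite_II.
by apply/finite_image/(finite_net _ cM (netL _))/exprz_gt0.
Qed.

End FiniteVertices.

(* Length of a shortest path; [0] when there is no path. *)
Definition graph_dist (R : realType) (X : finType) (e : rel X) (x y : X) : R :=
  inf [set (size p)%:R | p in [set p : seq X | path e x p /\ last x p = y]].

Section BanachMazur.
Variables (R : realType) (U V : vectType R) (nU : U -> R) (nV : V -> R).

Definition op_norm (U' V' : vectType R) (nU' : U' -> R) (nV' : V' -> R)
    (T : 'Hom(U', V')) : R :=
  sup [set nV' (T u) | u in [set u | nU' u <= 1]].

Definition banach_mazur : R :=
  inf [set op_norm nU nV TS.1 * op_norm nV nU TS.2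
      | TS in [set TS : 'Hom(U, V) * 'Hom(V, U) |
                cancel TS.1 TS.2 /\ cancel TS.2 TS.1]].

End BanachMazur.

Definition l1_norm (R : realType) (n : nat) (v : 'rV[R]_n) : R :=
  \sum_i `|v 0 i|.

(* The value of a representing function at the base point [o] is irrelevant, so
   elements of [F(X)] are functions on the complement of [o]. *)
Notation freespace R o := {ffun {x | x != o} -> R^o}.

Section TransportationCost.
Variables (R : realType) (X : finType) (d : X -> X -> R) (o : X).

Definition lip_norm (f : X -> R) : R :=
  inf [set C | 0 <= C /\ forall x y, `|f x - f y| <= C * d x y].

Definition pairing (mu : freespace R o) (f : X -> R) : R :=
  \sum_x mu x * f (val x).

Definition fnorm (mu : freespace R o) : R :=
  sup [set `|pairing mu f| | f in [set f | f o = 0 /\ lip_norm f <= 1]].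

Definition d1 : R :=
  banach_mazur fnorm (@l1_norm R #|X|.-1).

Definition d1_basis (b : #|X|.-1.-tuple (freespace R o)) : R :=
  sup [set \sum_n `|coord b n mu| * fnorm (tnth b n)
      | mu in [set mu | fnorm mu = 1]].

Definition restr (m : X -> R) : freespace R o := [ffun x => m (val x)].

Definition prob_on (S : {set X}) (p : X -> R) : Prop :=
  [/\ forall x, 0 <= p x, forall x, x \notin S -> p x = 0 & \sum_x p x = 1].

(* [P] is the linear extension of a map [Q] sending each point of [X] to a
   probability measure on [S]. *)
Definition stochastic_retraction (S : {set X})
    (P : freespace R o -> freespace R o) : Prop :=
  o \in S /\
  exists Q : X -> X -> R,
    [/\ forall x, prob_on S (Q x),
        forall x, x \in S -> forall y, Q x y = (y == x)%:R
      & forall mu, P mu = \sum_x mu x *: restr (Q (val x))].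

Definition canonical_proj (b : #|X|.-1.-tuple (freespace R o)) (n : nat)
    (mu : freespace R o) : freespace R o :=
  \sum_(i < #|X|.-1 | (i < n)%N) coord b i mu *: tnth b i.

Definition stochastic_basis (b : #|X|.-1.-tuple (freespace R o)) : Prop :=
  basis_of fullv b /\
  forall n, (n <= #|X|.-1)%N ->
    exists S : {set X}, stochastic_retraction S (canonical_proj b n).

Definition sd1 : R := inf [set d1_basis b | b in stochastic_basis].

End TransportationCost.

(* Main.v *)
Require Import Defs.
From HB Require Import structures.
From mathcomp Require Import all_boot all_order all_algebra.
From mathcomp Require Import finmap.
From mathcomp Require Import all_classical all_reals all_analysis.
From mathcomp Require Import zify ring lra.

Set Implicit Arguments.
Unset Strict Implicit.
Unset Printing Implicit Defensive.
Import Order.TTheory GRing.Theory Num.Theory.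
Local Open Scope classical_set_scope.
Local Open Scope ring_scope.

(** Order the vertices of the graph by layers, starting from the coarsest one,
    and let every vertex [v] other than the base point choose a parent uniformly
    among the points [w] of the next coarser layer, an [r ^ i]-net, such that
    [d(v, w) <= (1 + lambda * r) * r ^ i].  This defines a Markov chain which
    descends the layers to the base point.  With [K v] the law of the parent of
    [v], the vectors [delta_v - K v] form a stochastic basis: the law of the chain
    stopped on entering an initial segment of the ordering is a stochastic
    retraction, and two consecutive ones differ by a multiple of one basis vector
    ([kernel_basis_stochastic]).  Since parents are neighbours in the graph, the
    basis vectors have norm at most [1].

    The dual functionals are the probabilities of hitting a given vertex.  By
    duality, the constant of the basis is therefore at most the largest Lipschitz
    constant of a function [f] vanishing at the base point with
    [|f v - E f(parent of v)| <= 1] for all other [v] ([kernel_d1_basis_le]).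
    On a graph, a Lipschitz constant only has to be estimated along edges.

    Call two vertices of a layer close when they are equal or joined by a
    horizontal edge.  If every vertex has at most [C] parents, if close vertices
    have a common parent and if all their parents are close to one another, then
    the parents of two close vertices coincide with probability at least [1 / C]
    under a suitable coupling.  So the largest oscillation [B] of [f] over close
    pairs satisfies [B <= 2 + (1 - 1 / C) * B], that is [B <= 2 * C]
    ([near_oscillation]); the parents of the lower end of a radial edge being
    close to its upper end, radial edges cost at most [1 + 2 * C]
    ([edge_oscillation]).

    The radius [(1 + lambda * r) * r ^ i] is exactly what a common parent of
    horizontal neighbours requires ([close_common_parent]).  As parents are
    [r ^ i]-separated and [lambda * r < lambda / 6], the doubling property bounds
    their number by [D ^ n] with [2 ^ n <= 2 * lambda] ([card_parents],
    [halving_number]), and [D ^ n <= D * lambda ^ (log_2 D)].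

    The inequality between the two constants holds because the coordinates in a
    basis of constant [c], suitably normalised, are an isomorphism with [l_1^N]
    of distortion at most [c] ([d1_le_d1_basis]). *)

(** * The norm of the free space *)

Section FreeSpaceNorm.
Variables (R : realType) (X : finType) (d : X -> X -> R) (o : X).
Hypothesis d_ge0 : forall x y, 0 <= d x y.
Hypothesis d_gt0 : forall x y, x != y -> 0 < d x y.

Implicit Types (f : X -> R) (mu nu : freespace R o).

Lemma exists_lipschitz f :
  exists2 C, 0 <= C & forall x y, `|f x - f y| <= C * d x y.
Proof.
pose q x y := `|f x - f y| / d x y.
have q_ge0 x y : 0 <= q x y by rewrite divr_ge0.
exists (\sum_x \sum_y q x y) => [|x y].
  by do 2![apply: sumr_ge0 => ? _].
have [->|xy] := eqVneq x y.
  by rewrite subrr normr0 mulr_ge0//; do 2![apply: sumr_ge0 => ? _].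
rewrite -ler_pdivrMr ?d_gt0// (bigD1 x)//= (bigD1 y)//= -addrA lerDl.
rewrite addr_ge0//; first exact: sumr_ge0.
by do 2![apply: sumr_ge0 => ? _].
Qed.

Lemma lip_norm_le1 f : lip_norm d f <= 1 -> forall x y, `|f x - f y| <= d x y.
Proof.
move=> f1 x y; have [->|xy] := eqVneq x y; first by rewrite subrr normr0.
have [C0 C0_ge0 C0P] := exists_lipschitz f.
rewrite -[leRHS]mul1r -ler_pdivrMr ?d_gt0//; apply: le_trans f1.
apply: lb_le_inf => [|C [_ fC]]; first by exists C0.
by rewrite ler_pdivrMr ?d_gt0.
Qed.

Lemma lip_norm_le f (C : R) :
  0 <= C -> (forall x y, `|f x - f y| <= C * d x y) -> lip_norm d f <= C.
Proof. by move=> C0 fC; apply: ge_inf; [exists 0 => ? []|split]. Qed.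

Lemma pairingZ (a : R) mu f : pairing (a *: mu) f = a * pairing mu f.
Proof.
by rewrite mulr_sumr; apply: eq_bigr => x _; rewrite ffunE mulrA.
Qed.

Lemma pairingZr (a : R) mu f : pairing mu (fun x => a * f x) = a * pairing mu f.
Proof. by rewrite mulr_sumr; apply: eq_bigr => x _; rewrite mulrCA. Qed.

Lemma pairingD mu nu f : pairing (mu + nu) f = pairing mu f + pairing nu f.
Proof.
by rewrite -big_split; apply: eq_bigr => x _; rewrite ffunE mulrDl.
Qed.

Lemma fnorm_has_ubound mu : has_ubound
  [set `|pairing mu f| | f in [set f | f o = 0 /\ lip_norm d f <= 1]].
Proof.
exists (\sum_x `|mu x| * d (val x) o) => _ [f [fo /lip_norm_le1 f1] <-].
apply: le_trans (ler_norm_sum _ _ _) _; apply: ler_sum => x _.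
by rewrite normrM ler_wpM2l// -[f _]subr0 -fo.
Qed.

(** A Lipschitz function vanishing at the base point is a bounded functional on
    the free space: this one inequality yields every lower bound on the norm
    that is needed. *)
Lemma pairing_le_fnorm mu f (C : R) :
  f o = 0 -> 0 <= C -> (forall x y, `|f x - f y| <= C * d x y) ->
  `|pairing mu f| <= C * fnorm d mu.
Proof.
move=> fo; rewrite le_eqVlt => /predU1P[<-|C0] fC.
  have f0 x : f x = 0.
    by have := fC x o; rewrite fo subr0 mul0r normr_le0 => /eqP.
  by rewrite mul0r normr_le0 /pairing big1// => x _; rewrite f0 mulr0.
rewrite -ler_pdivrMl// -[X in X * _]gtr0_norm ?invr_gt0// -normrM -pairingZr.
apply: ub_le_sup; first exact: fnorm_has_ubound.
exists (fun x => C^-1 * f x) => //; split; first by rewrite fo mulr0.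
apply: lip_norm_le => // x y.
by rewrite mul1r -mulrBr normrM gtr0_norm ?invr_gt0// ler_pdivrMl.
Qed.

Lemma fnorm_le mu (B : R) :
  (forall f, f o = 0 -> (forall x y, `|f x - f y| <= d x y) ->
    `|pairing mu f| <= B) -> fnorm d mu <= B.
Proof.
move=> muB; apply: ge_sup => [|_ [f [fo /lip_norm_le1 f1] <-]]; last exact: muB.
exists `|pairing mu (fun=> 0)|, (fun=> 0) => //=; split => //.
by apply: lip_norm_le => // x y; rewrite subrr normr0 mul1r.
Qed.

Lemma pairing_le_fnorm1 mu f :
  f o = 0 -> (forall x y, `|f x - f y| <= d x y) -> `|pairing mu f| <= fnorm d mu.
Proof.
move=> fo f1; rewrite -[leRHS]mul1r; apply: pairing_le_fnorm => // x y.
by rewrite mul1r.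
Qed.

Lemma fnorm_ge0 mu : 0 <= fnorm d mu.
Proof.
apply: le_trans (normr_ge0 _) (@pairing_le_fnorm1 mu (fun=> 0) _ _) => // x y.
by rewrite subrr normr0.
Qed.

Lemma fnormZ_le (a : R) mu : fnorm d (a *: mu) <= `|a| * fnorm d mu.
Proof.
apply: fnorm_le => f fo f1.
by rewrite pairingZ normrM ler_wpM2l//; apply: pairing_le_fnorm1.
Qed.

Lemma fnormZ (a : R) mu : fnorm d (a *: mu) = `|a| * fnorm d mu.
Proof.
apply/eqP; rewrite eq_le fnormZ_le/=.
have [->|a0] := eqVneq a 0; first by rewrite normr0 mul0r fnorm_ge0.
rewrite -ler_pdivlMl ?normr_gt0// -normfV.
by rewrite -[in leLHS](scale1r mu) -(mulVf a0) -scalerA fnormZ_le.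
Qed.

Lemma fnormD mu nu : fnorm d (mu + nu) <= fnorm d mu + fnorm d nu.
Proof.
apply: fnorm_le => f fo f1; rewrite pairingD.
by rewrite (le_trans (ler_normD _ _))// lerD// pairing_le_fnorm1.
Qed.

Lemma fnorm0 : fnorm d (0 : freespace R o) = 0.
Proof. by rewrite -[0](scale0r 0) fnormZ normr0 mul0r. Qed.

Lemma fnorm_sum (I : finType) (F : I -> freespace R o) :
  fnorm d (\sum_i F i) <= \sum_i fnorm d (F i).
Proof.
apply: (big_ind2 (fun mu (B : R) => fnorm d mu <= B)) => //.
  by rewrite fnorm0.
by move=> mu B nu C muB nuC; rewrite (le_trans (fnormD _ _))// lerD.
Qed.

Lemma fnorm_eq0 mu : (fnorm d mu == 0) = (mu == 0).
Proof.
apply/eqP/eqP => [mu0|->]; last exact: fnorm0.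
apply/ffunP => x; pose f y : R := (y == val x)%:R.
have fo : f o = 0 by rewrite /f eq_sym (negbTE (valP x)).
have [C C0 fC] := exists_lipschitz f.
have := pairing_le_fnorm mu fo C0 fC; rewrite mu0 mulr0 normr_le0 => /eqP.
rewrite /pairing (bigD1 x)//= big1 => [|y yx].
  by rewrite /f eqxx mulr1 addr0 ffunE.
by rewrite /f (inj_eq val_inj) (negbTE yx) mulr0.
Qed.

Lemma fnorm_gt0 mu : (0 < fnorm d mu) = (mu != 0).
Proof. by rewrite lt0r fnorm_ge0 andbT fnorm_eq0. Qed.

Definition dirac_at (x : X) : freespace R o := restr o (fun y => (y == x)%:R).

Lemma dirac_sum mu : mu = \sum_x mu x *: dirac_at (val x).
Proof.
apply/ffunP => y; rewrite sum_ffunE (bigD1 y)//= !ffunE eqxx big1 => [|z zy].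
  by rewrite addr0; exact/esym/mulr1.
by rewrite !ffunE (inj_eq val_inj) eq_sym (negbTE zy); exact: mulr0.
Qed.

Lemma linear_pairing (phi : {linear freespace R o -> R^o}) mu :
  phi mu = pairing mu (fun x => phi (dirac_at x)).
Proof.
rewrite {1}(dirac_sum mu) linear_sum; apply: eq_bigr => x _.
by rewrite linearZ.
Qed.

Lemma dirac_at_base : dirac_at o = 0.
Proof. by apply/ffunP => x; rewrite !ffunE (negbTE (valP x)). Qed.

End FreeSpaceNorm.

(** * Banach-Mazur distance and bases *)

Section BanachMazurBasis.
Variables (R : realType) (X : finType) (d : X -> X -> R) (o : X).
Hypothesis d_ge0 : forall x y, 0 <= d x y.
Hypothesis d_gt0 : forall x y, x != y -> 0 < d x y.
Variable b : #|X|.-1.-tuple (freespace R o).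

Lemma d1_basis_has_ubound : has_ubound
  [set \sum_n `|coord b n mu| * fnorm d (tnth b n)
  | mu in [set mu | fnorm d mu = 1]].
Proof.
have /choice[C CP] n : exists C : R,
    forall mu, `|coord b n mu| <= C * fnorm d mu.
  have [C C0 fC] := exists_lipschitz d_ge0 d_gt0
    (fun x => coord b n (dirac_at R o x)).
  exists C => mu; rewrite (linear_pairing (coord b n)).
  by apply: (pairing_le_fnorm d_ge0 d_gt0) => //; rewrite dirac_at_base linear0.
exists (\sum_n C n * fnorm d (tnth b n)) => _ [mu mu1 <-].
apply: ler_sum => n _; rewrite ler_wpM2r ?fnorm_ge0//.
by rewrite (le_trans (CP n mu))// mu1 mulr1.
Qed.

Lemma d1_basis_ge0 : 0 <= d1_basis d b.
Proof.
have pos (mu : freespace R o) : 0 <= \sum_n `|coord b n mu| * fnorm d (tnth b n).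
  by apply: sumr_ge0 => n _; rewrite mulr_ge0// fnorm_ge0.
have [[mu mu1]|none] := pselect (exists mu : freespace R o, fnorm d mu = 1).
  apply: (le_trans (pos mu)); apply: ub_le_sup; first exact: d1_basis_has_ubound.
  by exists mu.
by rewrite /d1_basis sup_out// => -[[_ [mu mu1 _]] _]; apply: none; exists mu.
Qed.

Lemma sum_coord_le_d1_basis (mu : freespace R o) :
  \sum_n `|coord b n mu| * fnorm d (tnth b n) <= d1_basis d b * fnorm d mu.
Proof.
have [->|mu0] := eqVneq mu 0.
  by rewrite fnorm0// mulr0 big1// => n _; rewrite linear0 normr0 mul0r.
have mu_gt0 : 0 < fnorm d mu by rewrite fnorm_gt0.
rewrite -ler_pdivrMr// mulr_suml; apply: ub_le_sup; first exact: d1_basis_has_ubound.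
exists ((fnorm d mu)^-1 *: mu) => /=.
  by rewrite fnormZ// gtr0_norm ?invr_gt0// mulVf// gt_eqF.
apply: eq_bigr => n _; rewrite linearZ/= normrM gtr0_norm ?invr_gt0//.
by rewrite -mulrA [LHS]mulrC.
Qed.

Lemma d1_basis_le (K : R) : 0 <= K ->
  (forall mu : freespace R o,
    \sum_n `|coord b n mu| * fnorm d (tnth b n) <= K * fnorm d mu) ->
  d1_basis d b <= K.
Proof.
move=> K0 KP.
have [[mu mu1]|none] := pselect (exists mu : freespace R o, fnorm d mu = 1).
  apply: ge_sup => [|_ [nu nu1 <-]]; first by eexists; exists mu.
  by rewrite (le_trans (KP nu))// nu1 mulr1.
by rewrite /d1_basis sup_out// => -[[_ [mu mu1 _]] _]; apply: none; exists mu.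
Qed.

Lemma op_norm_ge0 (U V : vectType R) (nU : U -> R) (nV : V -> R) (T : 'Hom(U, V)) :
  (forall v, 0 <= nV v) -> 0 <= op_norm nU nV T.
Proof.
move=> nV0; rewrite /op_norm; set S := [set _ | _ in _].
have [[[_ [u u1 _]] S_ub]|noS] := pselect (has_sup S); last by rewrite sup_out.
by apply: (le_trans (nV0 (T u))); apply: ub_le_sup => //; exists u.
Qed.

Lemma op_norm_le (U V : vectType R) (nU : U -> R) (nV : V -> R)
    (T : 'Hom(U, V)) (K : R) :
  0 <= K -> nU 0 <= 1 -> (forall u, nV (T u) <= K * nU u) -> op_norm nU nV T <= K.
Proof.
move=> K0 nU0 TK; apply: ge_sup => [|_ [u u1 <-]]; first by exists (nV (T 0)), 0.
by apply: le_trans (TK u) _; rewrite ler_piMr.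
Qed.

Lemma l1_norm_ge0 n (v : 'rV[R]_n) : 0 <= l1_norm v.
Proof. exact: sumr_ge0. Qed.

Hypothesis b_basis : basis_of fullv b.

Definition weighted_coords (mu : freespace R o) : 'rV[R]_(#|X|.-1) :=
  \row_n (coord b n mu * fnorm d (tnth b n)).

Definition weighted_comb (v : 'rV[R]_(#|X|.-1)) : freespace R o :=
  \sum_n (v 0 n / fnorm d (tnth b n)) *: tnth b n.

Fact weighted_coords_linear : linear weighted_coords.
Proof. by move=> a mu nu; apply/rowP => n; rewrite !mxE linearP/= mulrDl mulrA. Qed.

Fact weighted_comb_linear : linear weighted_comb.
Proof.
move=> a v w; rewrite /weighted_comb scaler_sumr -big_split/=.
by apply: eq_bigr => n _; rewrite !mxE mulrDl scalerDl scalerA mulrA.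
Qed.

HB.instance Definition _ := GRing.isLinear.Build R _ _ _ weighted_coords
  weighted_coords_linear.
HB.instance Definition _ := GRing.isLinear.Build R _ _ _ weighted_comb
  weighted_comb_linear.

Lemma fnorm_basis_gt0 n : 0 < fnorm d (tnth b n).
Proof.
by rewrite fnorm_gt0// (free_not0 (basis_free b_basis))// mem_tnth.
Qed.

Lemma weighted_coordsK : cancel weighted_coords weighted_comb.
Proof.
move=> mu; rewrite [RHS](coord_basis b_basis (memvf mu)).
by apply: eq_bigr => n _; rewrite !mxE mulfK ?gt_eqF ?fnorm_basis_gt0// (tnth_nth 0).
Qed.

Lemma weighted_combK : cancel weighted_comb weighted_coords.
Proof.
move=> v; apply/rowP => n; rewrite mxE.
under [X in coord b n X]eq_bigr => i _ do rewrite [X in _ *: X](tnth_nth 0).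
rewrite coord_sum_free ?(basis_free b_basis)//= divfK//.
by rewrite gt_eqF ?fnorm_basis_gt0.
Qed.

(** Mapping the normalised basis vectors to the unit vectors gives an isomorphism
    with [l_1^N] whose inverse is a contraction, by the triangle inequality, and
    whose norm is at most the constant of the basis, by the definition of the
    latter. *)
Lemma d1_le_d1_basis : d1 d o <= d1_basis d b.
Proof.
pose T := linfun weighted_coords; pose S := linfun weighted_comb.
have T_le : op_norm (@fnorm R X d o) (@l1_norm R _) T <= d1_basis d b.
  apply: op_norm_le; [exact: d1_basis_ge0|by rewrite fnorm0|move=> mu].
  apply: le_trans _ (sum_coord_le_d1_basis mu).
  apply: ler_sum => n _.
  by rewrite lfunE/= mxE normrM [X in _ * X]ger0_norm// fnorm_ge0.
have S_le : op_norm (@l1_norm R _) (@fnorm R X d o) S <= 1.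
  apply: op_norm_le => //.
    by rewrite /l1_norm big1// => n _; rewrite mxE normr0.
  move=> v; rewrite lfunE/= mul1r; apply: le_trans (fnorm_sum d_ge0 d_gt0 _) _.
  apply: ler_sum => n _; rewrite fnormZ// normrM normfV.
  by rewrite [X in _ / X * _]ger0_norm ?fnorm_ge0// divfK// gt_eqF ?fnorm_basis_gt0.
apply: (@le_trans _ _ (op_norm (@fnorm R X d o) (@l1_norm R _) T *
                       op_norm (@l1_norm R _) (@fnorm R X d o) S)).
  apply: ge_inf; last first.
    exists (T, S) => //; split=> [mu|v] /=; rewrite !lfunE.
      exact: weighted_coordsK.
    exact: weighted_combK.
  exists 0 => _ [[T' S'] _ <-] /=.
  by rewrite mulr_ge0// op_norm_ge0//; [exact: l1_norm_ge0|exact: fnorm_ge0].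
rewrite -[leRHS]mulr1 ler_pM//; apply: op_norm_ge0.
  exact: l1_norm_ge0.
exact: fnorm_ge0.
Qed.

End BanachMazurBasis.

Lemma d1_le_sd1 (R : realType) (X : finType) (d : X -> X -> R) (o : X)
    (d_ge0 : forall x y, 0 <= d x y) (d_gt0 : forall x y, x != y -> 0 < d x y)
    (b : #|X|.-1.-tuple (freespace R o)) :
  stochastic_basis b -> d1 d o <= sd1 d o.
Proof.
move=> sb; apply: lb_le_inf => [|_ [c [c_basis _] <-]]; last exact: d1_le_d1_basis.
by exists (d1_basis d b), b.
Qed.

Lemma sd1_le (R : realType) (X : finType) (d : X -> X -> R) (o : X)
    (d_ge0 : forall x y, 0 <= d x y) (d_gt0 : forall x y, x != y -> 0 < d x y)
    (b : #|X|.-1.-tuple (freespace R o)) :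
  stochastic_basis b -> sd1 d o <= d1_basis d b.
Proof.
move=> sb; apply: ge_inf; last by exists b.
by exists 0 => _ [c _ <-]; exact: d1_basis_ge0.
Qed.

(** * Stochastic bases from Markov kernels *)

Section KernelBasis.
Variables (R : realType) (X : finType) (o : X) (ht : X -> nat) (K : X -> X -> R).
Hypothesis K_ge0 : forall x w, 0 <= K x w.
Hypothesis K_sum : forall x, x != o -> \sum_w K x w = 1.
Hypothesis K_decr : forall x w, x != o -> K x w != 0 -> (ht w < ht x)%N.

Local Notation N := #|X|.-1.

(** Sorting by height places the support of [K x] before [x], up to the base
    point, which is kept out of the list. *)
Definition by_height : seq X :=
  sort (relpre ht leq) (enum (predC1 o)).

Local Notation pt n := (nth o by_height n).

Lemma size_by_height : size by_height = N.
Proof. by rewrite size_sort -cardE cardC1. Qed.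

Lemma mem_by_height x : (x \in by_height) = (x != o).
Proof. by rewrite mem_sort mem_enum. Qed.

Lemma by_height_uniq : uniq by_height.
Proof. by rewrite sort_uniq enum_uniq. Qed.

Lemma pt_neq n : (n < N)%N -> pt n != o.
Proof. by move=> nN; rewrite -mem_by_height mem_nth// size_by_height. Qed.

Definition initial n : {set X} :=
  [set x | (x == o) || (index x by_height < n)%N].

Lemma pt_notin_initial n : (n < N)%N -> pt n \notin initial n.
Proof.
move=> nN; rewrite inE negb_or pt_neq//= index_uniq ?size_by_height ?ltnn//.
exact: by_height_uniq.
Qed.

Lemma initialS n x : (n < N)%N ->
  (x \in initial n.+1) = (x == pt n) || (x \in initial n).
Proof.
move=> nN; rewrite !inE ltnS leq_eqVlt.
have [->|xo] := eqVneq x o; first by rewrite orbT.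
rewrite /=; congr (_ || _); apply/eqP/eqP => [<-|->].
  by rewrite nth_index// mem_by_height.
by rewrite index_uniq ?size_by_height ?by_height_uniq.
Qed.

Lemma initialN x : x \in initial N.
Proof.
by rewrite inE -size_by_height index_mem mem_by_height orbN.
Qed.

Lemma initial0 x : (x \in initial 0) = (x == o).
Proof. by rewrite inE orbF. Qed.

Lemma kernel_supp n w : (n < N)%N -> K (pt n) w != 0 -> w \in initial n.
Proof.
move=> nN /(K_decr (pt_neq nN)); rewrite inE; have [//|wo /=] := eqVneq w o.
apply: contraTT; rewrite -!leqNgt => nw.
have w_in : w \in by_height by rewrite mem_by_height.
rewrite -[w in leqRHS](nth_index o w_in).
have tr : transitive (relpre ht leq) by move=> ? ? ?; exact: leq_trans.
apply: (@sorted_leq_nth _ (relpre ht leq) tr _ o) => //=.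
- by move=> ?; exact: leqnn.
- by apply: sort_sorted => x y; exact: leq_total.
- by rewrite inE size_by_height.
- by rewrite inE index_mem.
Qed.

(** The law, for the chain started at [x], of its position on entering
    [initial (N - j)].  Increasing [j] by one removes a single point [p] from this
    target; it suffices to redistribute the mass sitting at [p] according to
    [K p], because [K p] is carried by the smaller target. *)
Fixpoint stopped_rec (j : nat) (x y : X) : R :=
  if j is j'.+1 then
    let p := pt (N - j) in
    (y != p)%:R * stopped_rec j' x y + stopped_rec j' x p * K p y
  else (y == x)%:R.

Definition stopped n := stopped_rec (N - n).

Lemma stoppedN x y : stopped N x y = (y == x)%:R.
Proof. by rewrite /stopped subnn. Qed.

Lemma stoppedE n x y : (n < N)%N ->
  stopped n x y =
  (y != pt n)%:R * stopped n.+1 x y + stopped n.+1 x (pt n) * K (pt n) y.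
Proof.
move=> nN; rewrite {1}/stopped -subnSK// /= -/(stopped n.+1) subnSK//.
by rewrite subKn// ltnW.
Qed.

Lemma stopped_prob n x : (n <= N)%N ->
  prob_on (initial n) (stopped n x) /\
  (x \in initial n -> forall y, stopped n x y = (y == x)%:R).
Proof.
move=> nN; rewrite -(subKn nN); move: (N - n)%N (leq_subr n N) => j.
elim: j => [_|j IHj jN].
  rewrite subn0; split=> [|_ y]; last exact: stoppedN.
  split=> [y|y|]; first by rewrite stoppedN ler0n.
    by rewrite initialN.
  rewrite (bigD1 x)//= stoppedN eqxx big1 ?addr0// => y yx.
  by rewrite stoppedN (negbTE yx).
set m := (N - j.+1)%N; have mN : (m < N)%N by rewrite /m; lia.
have [] := IHj (ltnW jN); rewrite (_ : N - j = m.+1)%N; last by rewrite /m; lia.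
move=> [s_ge0 s_out s_sum] s_id; split.
  split=> [y|y|].
  - by rewrite stoppedE// addr_ge0 ?mulr_ge0.
  - move=> ym; rewrite stoppedE//; have [->|yp] := eqVneq y (pt m).
      rewrite mul0r add0r (_ : K _ _ = 0) ?mulr0//; apply/eqP.
      exact: contraNT (kernel_supp mN) (pt_notin_initial mN).
    rewrite s_out ?initialS// ?negb_or ?yp// mulr0 add0r.
    rewrite (_ : K _ _ = 0) ?mulr0//; apply/eqP.
    exact: contraNT (kernel_supp mN) ym.
  under eq_bigr => y _ do rewrite stoppedE//.
  rewrite big_split/= -mulr_sumr K_sum ?pt_neq// mulr1.
  rewrite -[RHS]s_sum [RHS](bigD1 (pt m))//= addrC; congr (_ + _).
  rewrite (bigD1 (pt m))//= eqxx mul0r add0r.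
  by apply: eq_bigr => y ->; rewrite mul1r.
move=> xm y.
have xp : x != pt m by apply: contraNneq (pt_notin_initial mN) => <-.
rewrite stoppedE// !s_id ?initialS ?xm ?orbT//.
rewrite (eq_sym (pt m)) (negbTE xp) mul0r addr0.
by have [->|_] := eqVneq y (pt m); rewrite ?mul1r// mul0r eq_sym (negbTE xp).
Qed.

Definition kernel_vec n : freespace R o :=
  restr o (fun y => (y == pt n)%:R - K (pt n) y).

(** On the indicator of a point [x], this is the probability that the chain
    started at [x] visits [pt n]: the position on entering [initial n.+1] is
    [pt n] exactly when the chain visits it. *)
Definition hitting n (mu : freespace R o) : R :=
  \sum_x mu x * stopped n.+1 (val x) (pt n).

Definition stopped_proj n (mu : freespace R o) : freespace R o :=
  \sum_x mu x *: restr o (stopped n (val x)).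

Lemma stopped_projE n mu y :
  stopped_proj n mu y = \sum_x mu x * stopped n (val x) (val y).
Proof.
by rewrite /stopped_proj sum_ffunE; apply: eq_bigr => x _; rewrite !ffunE.
Qed.

(** Redistributing the mass found at [pt n] changes the projection along
    [kernel_vec n] only.  Summing these increments produces at once the spanning
    property, the coordinates and the canonical projections of the basis. *)
Lemma stopped_projS n mu : (n < N)%N ->
  stopped_proj n.+1 mu = stopped_proj n mu + hitting n mu *: kernel_vec n.
Proof.
move=> nN; apply/ffunP => y; rewrite ffunE ffunE !stopped_projE ffunE.
rewrite /hitting [X in _ + X]mulr_suml -big_split/=; apply: eq_bigr => x _.
rewrite (@stoppedE n)//; case: eqVneq => [->|_] /=; ring.
Qed.

Lemma stopped_projN mu : stopped_proj N mu = mu.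
Proof.
apply/ffunP => y; rewrite stopped_projE (bigD1 y)//= stoppedN eqxx mulr1.
rewrite big1 ?addr0// => x xy.
by rewrite stoppedN (inj_eq val_inj) eq_sym (negbTE xy) mulr0.
Qed.

Lemma stopped_proj0 mu : stopped_proj 0 mu = 0.
Proof.
apply/ffunP => y; rewrite stopped_projE ffunE big1// => x _.
have [[_ s_out _] _] := stopped_prob (val x) (leq0n N).
by rewrite s_out ?mulr0// initial0 (valP y).
Qed.

Lemma stopped_proj_sum n mu : (n <= N)%N ->
  stopped_proj n mu = \sum_(i < n) hitting i mu *: kernel_vec i.
Proof.
elim: n => [|n IHn] nN; first by rewrite big_ord0 stopped_proj0.
by rewrite stopped_projS// IHn ?(ltnW nN)// big_ord_recr.
Qed.

Definition kernel_basis : N.-tuple (freespace R o) :=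
  [tuple kernel_vec i | i < N].

Lemma tnth_kernel_basis i : tnth kernel_basis i = kernel_vec i.
Proof. exact: tnth_mktuple. Qed.

Lemma kernel_sum (mu : freespace R o) :
  mu = \sum_(i < N) hitting i mu *: kernel_basis`_i.
Proof.
rewrite -[LHS]stopped_projN stopped_proj_sum//; apply: eq_bigr => i _.
by rewrite -tnth_nth tnth_kernel_basis.
Qed.

Lemma dim_freespace : \dim {:freespace R o} = N.
Proof. by rewrite dimvf /dim/= muln1 card_sig cardC1. Qed.

Lemma kernel_basisP : basis_of fullv kernel_basis.
Proof.
rewrite basisEdim size_tuple dim_freespace leqnn andbT.
apply/subvP => mu _; rewrite (kernel_sum mu); apply: memv_suml => i _.
by rewrite memvZ// memv_span// mem_nth// size_tuple.
Qed.

Lemma coord_kernel_basis (i : 'I_N) mu : coord kernel_basis i mu = hitting i mu.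
Proof.
by rewrite [in LHS](kernel_sum mu) coord_sum_free// (basis_free kernel_basisP).
Qed.

Lemma kernel_basis_stochastic : stochastic_basis kernel_basis.
Proof.
split; first exact: kernel_basisP.
move=> n nN; exists (initial n); split; first by rewrite inE eqxx.
exists (stopped n); split=> [x|x|mu]; [|by apply: (stopped_prob x nN).2|].
  exact: (stopped_prob x nN).1.
rewrite -/(stopped_proj n mu) stopped_proj_sum//.
rewrite (big_ord_widen N (fun i => hitting i mu *: kernel_vec i))//.
by apply: eq_bigr => i _; rewrite coord_kernel_basis tnth_kernel_basis.
Qed.

Lemma kernel_vec_dirac n : kernel_vec n =
  dirac_at R o (pt n) - \sum_w K (pt n) w *: dirac_at R o w.
Proof.
apply/ffunP => y; rewrite !ffunE sum_ffunE.
suff -> : \sum_w (K (pt n) w *: dirac_at R o w) y = K (pt n) (val y) by [].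
rewrite (bigD1 (val y))//= !ffunE eqxx big1 => [|w wy].
  by rewrite addr0; exact: mulr1.
by rewrite !ffunE eq_sym (negbTE wy); exact: mulr0.
Qed.

(** Evaluating the combination on the basis vector [delta_(pt n) - K (pt n)] by
    biorthogonality. *)
Lemma coord_comb_rec (a : 'I_N -> R) (f : X -> R) :
  (forall x, f x = \sum_i a i * coord kernel_basis i (dirac_at R o x)) ->
  forall n : 'I_N, f (pt n) - \sum_w K (pt n) w * f w = a n.
Proof.
move=> fE n.
transitivity (\sum_i a i * coord kernel_basis i (kernel_vec n)).
  rewrite fE; under [X in _ - X]eq_bigr => w _ do rewrite fE mulr_sumr.
  rewrite exchange_big -sumrB; apply: eq_bigr => i _.
  rewrite kernel_vec_dirac linearB mulrBr; congr (_ - _).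
  by rewrite linear_sum mulr_sumr; apply: eq_bigr => w _; rewrite linearZ/= mulrCA.
rewrite -tnth_kernel_basis (tnth_nth 0) (bigD1 n)//=.
rewrite coord_free ?(basis_free kernel_basisP)// eqxx mulr1.
rewrite big1 ?addr0// => i ni.
by rewrite coord_free ?(basis_free kernel_basisP)// eq_sym (negbTE ni) mulr0.
Qed.

Lemma kernel_vec_pairing n f : f o = 0 -> (n < N)%N ->
  pairing (kernel_vec n) f = f (pt n) - \sum_w K (pt n) w * f w.
Proof.
move=> fo nN; rewrite /pairing.
under eq_bigr => x _ do rewrite ffunE.
have -> : f (pt n) = \sum_w (w == pt n)%:R * f w.
  rewrite (bigD1 (pt n))//= eqxx mul1r big1 ?addr0// => w /negbTE ->.
  by rewrite mul0r.
rewrite -sumrB [RHS](bigD1 o)//= fo !mulr0 subr0 add0r.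
under [RHS]eq_bigr => w _ do rewrite -mulrBl.
pose F w := ((w == pt n)%:R - K (pt n) w) * f w.
exact/esym/(big_sub [pred w | w != o] F).
Qed.

Variable d : X -> X -> R.
Hypothesis d_ge0 : forall x y, 0 <= d x y.
Hypothesis d_gt0 : forall x y, x != y -> 0 < d x y.
Hypothesis K_short : forall x w, x != o -> K x w != 0 -> d x w <= 1.

Lemma kernel_vec_fnorm n : (n < N)%N -> fnorm d (kernel_vec n) <= 1.
Proof.
move=> nN; have po := pt_neq nN; apply: (fnorm_le d_ge0 d_gt0) => f fo f1.
rewrite kernel_vec_pairing// -[f _]mul1r -(K_sum po) mulr_suml -sumrB.
apply: le_trans (ler_norm_sum _ _ _) _; apply: ler_sum => w _.
rewrite -mulrBr normrM ger0_norm//.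
have [->|Kw] := eqVneq (K (pt n) w) 0; first by rewrite mul0r.
by rewrite ler_piMr// (le_trans (f1 _ _))// K_short.
Qed.

(** Testing the sum of the coordinates of [mu] against their signs turns it into
    [pairing mu f] for a combination [f] of the dual basis.  The dual basis
    consists of hitting probabilities, so [f] is harmonic for [K] up to an error
    of at most [1] at each point, and only a Lipschitz bound for such functions
    is left to prove. *)
Lemma kernel_d1_basis_le (B : R) : 0 <= B ->
  (forall f : X -> R, f o = 0 ->
    (forall x, x != o -> `|f x - \sum_w K x w * f w| <= 1) ->
    forall x y, `|f x - f y| <= B * d x y) ->
  d1_basis d kernel_basis <= B.
Proof.
move=> B0 lipB; apply: d1_basis_le => // mu.
pose a n := Num.sg (coord kernel_basis n mu) * fnorm d (tnth kernel_basis n).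
pose f x := \sum_n a n * coord kernel_basis n (dirac_at R o x).
have fo : f o = 0.
  by rewrite /f dirac_at_base big1// => n _; rewrite linear0 mulr0.
have a_le n : `|a n| <= 1.
  rewrite normrM normr_sg ger0_norm ?fnorm_ge0// tnth_kernel_basis.
  by case: eqP => _; rewrite ?mul0r ?mul1r ?kernel_vec_fnorm.
have f_drift x : x != o -> `|f x - \sum_w K x w * f w| <= 1.
  rewrite -mem_by_height => x_in.
  have xN : (index x by_height < N)%N by rewrite -size_by_height index_mem.
  have := @coord_comb_rec a f (fun=> erefl) (Ordinal xN).
  by rewrite /= nth_index// => ->.
suff -> : \sum_n `|coord kernel_basis n mu| * fnorm d (tnth kernel_basis n) =
          pairing mu f.
  apply: le_trans (ler_norm _) _.
  exact: pairing_le_fnorm d_ge0 d_gt0 _ _ _ fo B0 (lipB f fo f_drift).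
transitivity (\sum_n a n * coord kernel_basis n mu).
  by apply: eq_bigr => n _; rewrite /a mulrAC -normrEsg.
under eq_bigr => n _ do rewrite (linear_pairing (coord kernel_basis n)) mulr_sumr.
rewrite exchange_big; apply: eq_bigr => x _.
by rewrite mulr_sumr; apply: eq_bigr => n _; rewrite mulrCA.
Qed.

End KernelBasis.

(** * Graph distances *)

Section GraphDistance.
Variables (R : realType) (X : finType) (e : rel X).

Local Notation gd := (graph_dist R e).

Lemma graph_dist_le x p : path e x p -> gd x (last x p) <= (size p)%:R.
Proof.
move=> xp; apply: ge_inf; last by exists p.
by exists 0 => _ [q _ <-]; exact: ler0n.
Qed.

Lemma graph_dist_ge x y (c : R) : connect e x y ->
  (forall p, path e x p -> last x p = y -> c <= (size p)%:R) -> c <= gd x y.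
Proof.
case/connectP=> p xp yp cP; apply: lb_le_inf; first by eexists; exists p.
by move=> _ [q [xq yq] <-]; exact: cP.
Qed.

Lemma graph_dist_ge0 x y : 0 <= gd x y.
Proof.
rewrite /graph_dist; set S := [set _ | _ in _].
have [S0|noS] := pselect (S !=set0); last by rewrite inf_out// => -[].
by apply: lb_le_inf => // _ [p _ <-]; exact: ler0n.
Qed.

Lemma graph_dist_gt0 x y : connect e x y -> x != y -> 0 < gd x y.
Proof.
move=> cxy xy; apply: (@lt_le_trans _ _ 1) => //.
apply: graph_dist_ge => // -[/= _ xy'|z p _ _]; first by rewrite xy' eqxx in xy.
by rewrite ler1n.
Qed.

Lemma graph_dist_edge x y : e x y -> gd x y <= 1.
Proof. by move=> exy; apply: (@graph_dist_le x [:: y]); rewrite /= exy. Qed.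

Lemma edge_lipschitz (f : X -> R) (B : R) : 0 < B ->
  (forall x y, e x y -> `|f x - f y| <= B) ->
  forall x y, connect e x y -> `|f x - f y| <= B * gd x y.
Proof.
move=> B0 fB x y cxy; rewrite -ler_pdivrMl//; apply: graph_dist_ge => // p xp <-.
rewrite ler_pdivrMl//; elim: p x xp {cxy} => [x _|z p IHp x] /=.
  by rewrite subrr normr0 mulr0.
move=> /andP[exz zp]; rewrite -natr1 mulrDr mulr1 [leRHS]addrC.
by rewrite (le_trans (ler_distD (f z) _ _))// lerD ?fB ?IHp.
Qed.

End GraphDistance.

(** * Layered graphs *)

(** Two probability measures sharing a mass [t] at some point see a function at
    most [1 - t] times as far apart as single points of their supports do: the
    shared masses cancel, and the product of the remainders couples the rest. *)
Lemma shared_mass_contraction (R : realFieldType) (X : finType) (p q f : X -> R)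
    (z : X) (t B : R) :
  (forall w, 0 <= p w) -> (forall w, 0 <= q w) ->
  \sum_w p w = 1 -> \sum_w q w = 1 ->
  0 <= t -> t <= p z -> t <= q z ->
  (forall w v, p w != 0 -> q v != 0 -> `|f w - f v| <= B) ->
  `|\sum_w p w * f w - \sum_w q w * f w| <= (1 - t) * B.
Proof.
move=> p0 q0 p1 q1 t0 tp tq fB.
pose rest (m : X -> R) w := m w - (w == z)%:R * t.
have rest_ge0 (m : X -> R) : (forall w, 0 <= m w) -> t <= m z ->
    forall w, 0 <= rest m w.
  move=> m0 tm w; rewrite /rest; case: eqVneq => [->|_].
    by rewrite mul1r subr_ge0.
  by rewrite mul0r subr0.
have rest_supp (m : X -> R) : (forall w, 0 <= m w) -> t <= m z ->
    forall w, rest m w != 0 -> m w != 0.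
  move=> m0 tm w; apply: contraNN => /eqP mw; rewrite eq_le rest_ge0// andbT.
  by rewrite /rest mw sub0r oppr_le0 mulr_ge0.
have sum_z (g : X -> R) : \sum_w (w == z)%:R * t * g w = t * g z.
  rewrite (bigD1 z)//= eqxx mul1r big1 ?addr0// => w /negbTE ->.
  by rewrite !mul0r.
have rest_sum (m : X -> R) : \sum_w m w = 1 -> \sum_w rest m w = 1 - t.
  move=> m1; rewrite sumrB m1; congr (_ - _).
  by rewrite -[RHS]mulr1 -(sum_z (fun=> 1)); apply: eq_bigr => w _; rewrite mulr1.
have -> : \sum_w p w * f w - \sum_w q w * f w =
          \sum_w rest p w * f w - \sum_w rest q w * f w.
  have E (m : X -> R) : \sum_w m w * f w = \sum_w rest m w * f w + t * f z.
    by rewrite -sum_z -big_split/=; apply: eq_bigr => w _; rewrite -mulrDl subrK.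
  by rewrite (E p) (E q); ring.
have t1 : 0 <= 1 - t by rewrite -(rest_sum p p1) sumr_ge0// => w _; exact: rest_ge0.
(* When all the mass is shared, there is no remainder to normalise. *)
move: t1; rewrite le_eqVlt => /predU1P[t1|t1].
  have rest0 (m : X -> R) : (forall w, 0 <= m w) -> t <= m z -> \sum_w m w = 1 ->
      \sum_w rest m w * f w = 0.
    move=> m0 tm m1; have := rest_sum m m1; rewrite -t1 => m'0.
    have rest00 := psumr_eq0P (fun w _ => rest_ge0 m m0 tm w) m'0.
    by rewrite big1// => w _; rewrite rest00// mul0r.
  by rewrite !rest0// subrr normr0 -t1 mul0r.
rewrite -(ler_pM2l t1) -{1}(gtr0_norm t1) -normrM.
have -> : (1 - t) * (\sum_w rest p w * f w - \sum_w rest q w * f w) =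
    \sum_w \sum_v rest p w * rest q v * (f w - f v).
  rewrite mulrBr -{1}(rest_sum q q1) -(rest_sum p p1) !mulr_suml.
  under [X in X - _]eq_bigr => v _ do rewrite mulr_sumr.
  under [X in _ - X]eq_bigr => w _ do rewrite mulr_sumr.
  rewrite [X in X - _]exchange_big -sumrB; apply: eq_bigr => w _.
  by rewrite -sumrB; apply: eq_bigr => v _; ring.
apply: (@le_trans _ _ (\sum_w \sum_v rest p w * rest q v * B)); last first.
  rewrite -{1}(rest_sum p p1) -(rest_sum q q1) mulr_suml; apply: ler_sum => w _.
  by rewrite mulr_suml mulr_sumr; apply: ler_sum => v _; rewrite mulrA.
apply: le_trans (ler_norm_sum _ _ _) _; apply: ler_sum => w _.
apply: le_trans (ler_norm_sum _ _ _) _; apply: ler_sum => v _.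
have pq0 : 0 <= rest p w * rest q v by rewrite mulr_ge0 ?rest_ge0.
rewrite normrM (ger0_norm pq0).
have [->|pw] := eqVneq (rest p w) 0; first by rewrite !mul0r.
have [->|qv] := eqVneq (rest q v) 0; first by rewrite mulr0 !mul0r.
by rewrite ler_wpM2l// fB//; [exact: rest_supp pw|exact: rest_supp qv].
Qed.

Section LayeredGraph.
Variables (R : realType) (X : finType) (o : X) (e : rel X) (ht : X -> nat).
Variables (A : X -> {set X}) (near : X -> X -> Prop) (C : nat).
Hypothesis e_sym : symmetric e.
Hypothesis ht_base : ht o = 0%N.
Hypothesis ht_eq0 : forall x, ht x = 0%N -> x = o.
Hypothesis A_nonempty : forall x, x != o -> exists w, w \in A x.
Hypothesis card_A : forall x, x != o -> (#|A x| <= C)%N.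
Hypothesis A_edge : forall x w, x != o -> w \in A x -> e x w.
Hypothesis A_ht : forall x w, x != o -> w \in A x -> ht x = (ht w).+1.
Hypothesis near_ht : forall x y, near x y -> ht x = ht y.
Hypothesis near_common : forall x y, x != o -> y != o -> near x y ->
  exists w, w \in A x /\ w \in A y.
Hypothesis near_parents : forall x y w v, x != o -> y != o -> near x y ->
  w \in A x -> v \in A y -> near w v.
Hypothesis edge_near : forall x y, e x y ->
  [\/ near x y, y != o /\ (forall w, w \in A y -> near w x)
    | x != o /\ (forall w, w \in A x -> near w y)].

Let K (x w : X) : R := (w \in A x)%:R / #|A x|%:R.

Let K_ge0 x w : 0 <= K x w. Proof. by rewrite divr_ge0. Qed.

Let K_neq0 x w : K x w != 0 -> w \in A x.
Proof. by apply: contraNT => /negbTE wA; rewrite /K wA mul0r. Qed.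

Let card_A_gt0 x : x != o -> (0 < #|A x|)%N.
Proof. by move=> /A_nonempty ex; apply/card_gt0P. Qed.

Let K_sum x : x != o -> \sum_w K x w = 1.
Proof.
move=> xo; rewrite -mulr_suml -natr_sum.
rewrite (_ : (\sum_w (w \in A x))%N = #|A x|).
  by rewrite divff// pnatr_eq0 -lt0n card_A_gt0.
by rewrite -sum1_card [RHS]big_mkcond; apply: eq_bigr => w _; case: (w \in A x).
Qed.

Let K_decr x w : x != o -> K x w != 0 -> (ht w < ht x)%N.
Proof. by move=> xo /K_neq0 /(A_ht xo) ->. Qed.

Let C_gt0 x : x != o -> (0 < C)%N.
Proof. by move=> xo; exact: leq_trans (card_A_gt0 xo) (card_A xo). Qed.

Let K_ge x w : x != o -> w \in A x -> C%:R^-1 <= K x w.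
Proof.
move=> xo wA; rewrite /K wA mul1r lef_pV2 ?posrE ?ltr0n ?ler_nat ?card_A//.
  exact: C_gt0 xo.
exact: card_A_gt0.
Qed.

Let connected x y : connect e x y.
Proof.
have to_base z : connect e z o.
  elim: (ht z) {-2}z (erefl (ht z)) => [u /ht_eq0 -> //|n IHn u hu].
  have [->//|uo] := eqVneq u o; have [w wA] := A_nonempty uo.
  apply: connect_trans (connect1 (A_edge uo wA)) (IHn w _).
  by have := A_ht uo wA; rewrite hu => -[].
by apply: connect_trans (to_base x) _; rewrite (sym_connect_sym e_sym).
Qed.

(** One step of the chain costs a drift of at most [1] at either point, hence
    [2] for a pair; the common parent makes the oscillation seen afterwards shrink
    by the factor [1 - 1 / C]; and [2 * C] is the fixed point of
    [B = 2 + (1 - 1 / C) * B]. *)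
Lemma near_oscillation (f : X -> R) :
  (forall x, x != o -> `|f x - \sum_w K x w * f w| <= 1) ->
  forall x y, near x y -> `|f x - f y| <= 2 * C%:R.
Proof.
move=> f_drift x; elim: (ht x) {-2}x (erefl (ht x)) => {x} [|n IHn] x hx y xy.
  by rewrite (ht_eq0 hx) (@ht_eq0 y) -?(near_ht xy)// subrr normr0 mulr_ge0.
have xo : x != o by apply: contra_eq_neq hx => ->; rewrite ht_base.
have yo : y != o.
  by apply: contra_eq_neq hx => yo; rewrite (near_ht xy) yo ht_base.
have [w0 [w0x w0y]] := near_common xo yo xy.
have C0 : 0 < C%:R :> R by rewrite ltr0n (C_gt0 xo).
have : `|\sum_w K x w * f w - \sum_w K y w * f w| <= (1 - C%:R^-1) * (2 * C%:R).
  apply: (@shared_mass_contraction _ _ _ _ _ w0) => //; try exact: K_sum.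
  - exact: K_ge.
  - exact: K_ge.
  move=> w v /K_neq0 wA /K_neq0 vA.
  have hw : ht w = n by have := A_ht xo wA; rewrite hx => -[].
  exact: (IHn w hw v (near_parents xo yo xy wA vA)).
rewrite (_ : (1 - _) * _ = 2 * C%:R - 2); last first.
  by field; rewrite gt_eqF.
have := f_drift x xo; have := f_drift y yo.
by rewrite !ler_norml => /andP[? ?] /andP[? ?] /andP[? ?]; apply/andP; split; lra.
Qed.

(** Along a radial edge, one step of the chain from the lower end leads to a point
    close to the upper end, at the cost of a drift of at most [1]. *)
Lemma edge_oscillation (f : X -> R) :
  (forall x, x != o -> `|f x - \sum_w K x w * f w| <= 1) ->
  forall x y, e x y -> `|f x - f y| <= 1 + 2 * C%:R.
Proof.
move=> f_drift.
have radial_osc x y : y != o -> (forall w, w \in A y -> near w x) ->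
    `|f y - f x| <= 1 + 2 * C%:R.
  move=> yo yx; rewrite (le_trans (ler_distD (\sum_w K y w * f w) _ _))//.
  rewrite lerD ?f_drift//.
  rewrite -[f x]mul1r -[X in X * f x](K_sum yo) mulr_suml -sumrB.
  rewrite -[leRHS]mul1r -[X in X * (2 * _)](K_sum yo) mulr_suml.
  apply: le_trans (ler_norm_sum _ _ _) _; apply: ler_sum => w _.
  rewrite -mulrBr normrM ger0_norm//.
  have [->|/K_neq0 wA] := eqVneq (K y w) 0; first by rewrite !mul0r.
  by rewrite ler_wpM2l//; apply: near_oscillation => //; exact: yx.
move=> x y /edge_near[xy|[yo yx]|[xo xy]].
- by rewrite (le_trans (near_oscillation f_drift xy))// lerDr.
- by rewrite distrC radial_osc.
- exact: radial_osc.
Qed.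

Theorem layered_graph_sd1 :
  d1 (graph_dist R e) o <= sd1 (graph_dist R e) o /\
  sd1 (graph_dist R e) o <= 1 + 2 * C%:R.
Proof.
have d_ge0 x y := @graph_dist_ge0 R X e x y.
have d_gt0 x y : x != y -> 0 < graph_dist R e x y.
  exact: graph_dist_gt0 (connected x y).
have b_stoch := kernel_basis_stochastic K_ge0 K_sum K_decr.
split; first exact: d1_le_sd1 b_stoch.
apply: le_trans (sd1_le d_ge0 d_gt0 b_stoch) _.
have B_gt0 : 0 < 1 + 2 * C%:R :> R by rewrite ltr_pwDl// mulr_ge0.
apply: kernel_d1_basis_le => //.
  by move=> x w xo /K_neq0 wA; apply: graph_dist_edge; exact: A_edge.
move=> f fo f_drift x y; apply: edge_lipschitz => // u v.
exact: edge_oscillation.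
Qed.

End LayeredGraph.

(** * Doubling metric spaces *)

Section Packing.
Variables (R : realType) (M : metricType R) (D : nat).
Hypothesis M_doubling : doubling M D.

Lemma doubling_cover (x : M) (rho : R) (n : nat) : 0 < rho ->
  exists s : seq M, size s = (D ^ n)%N /\
    forall z, mdist z x <= rho ->
      exists2 c, c \in s & mdist z c <= rho / 2 ^+ n.
Proof.
move=> rho0; elim: n => [|n [s [s_size sP]]].
  exists [:: x]; split=> // z zx.
  by exists x; rewrite ?mem_head// expr0 divr1.
have /choice[c cP] y := M_doubling y (divr_gt0 rho0 (exprn_gt0 n (ltr0Sn R 1))).
exists [seq c y i | y <- s, i <- enum 'I_D]; split.
  by rewrite size_allpairs s_size size_enum_ord expnSr.
move=> z /sP[y ys zy]; have [i _ zi] := cP y z zy; exists (c y i).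
  by apply: allpairs_f => //; rewrite mem_enum.
by rewrite exprSr invfM mulrA.
Qed.

Lemma doubling_packing (x : M) (rho delta : R) (n : nat)
    (T : finType) (A : {set T}) (h : T -> M) :
  0 < rho -> 2 * rho / 2 ^+ n < delta ->
  (forall t, t \in A -> mdist (h t) x <= rho) ->
  (forall t u, t \in A -> u \in A -> t != u -> delta <= mdist (h t) (h u)) ->
  (#|A| <= D ^ n)%N.
Proof.
move=> rho0 rho_delta hA h_sep.
have [s [s_size sP]] := doubling_cover x n rho0.
have /choice[c cP] t : exists c, t \in A -> c \in s /\ mdist (h t) c <= rho / 2 ^+ n.
  have [/hA/sP[c ? ?]|_] := boolP (t \in A); first by exists c.
  by exists x.
rewrite -s_size cardE -(size_map c); apply: uniq_leq_size.
  rewrite map_inj_in_uniq ?enum_uniq// => t u; rewrite !mem_enum => tA uA ctu.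
  apply/eqP; apply: contraTT rho_delta => tu; rewrite -leNgt.
  apply: le_trans (h_sep t u tA uA tu) _.
  apply: le_trans (metric_triangle (h t) (c t) (h u)) _.
  rewrite {2}ctu (metric_sym (c u)) -mulrA mulr_natl mulr2n.
  by rewrite lerD// ?(cP t tA).2 ?(cP u uA).2.
by move=> _ /mapP[t + ->]; rewrite mem_enum => /cP[].
Qed.

End Packing.

(** Balls of radius [(1 + lambda * r) * rho] have to be split [n] times to
    separate [rho]-separated points, and [n <= 1 + log_2 lambda] is affordable.
    The least [n] with [lambda < 2 ^ n] works.  Indeed [lambda * r < lambda / 6],
    hence [2 * (1 + lambda * r) < 2 + lambda / 3], and the latter is at most
    [lambda] when [lambda >= 3], and less than [4 <= 2 ^ n] otherwise. *)
Lemma halving_number (R : realType) (lambda r : R) :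
  2 <= lambda -> 0 < r -> r < 1 / 6 ->
  exists n, 2 * (1 + lambda * r) < 2 ^+ n <= 2 * lambda.
Proof.
move=> l2 r0 r6.
have ex_n : exists n, lambda < 2 ^+ n.
  have l0 : 0 <= lambda by lra.
  exists (Num.bound lambda); apply: lt_le_trans (archi_boundP l0) _.
  by rewrite -natrX ler_nat ltnW// ltn_expl.
case: (ex_minnP ex_n) => n ln n_min; exists n.
have n2 : (2 <= n)%N.
  rewrite leqNgt; apply/negP => n1; move: ln; apply/negP; rewrite -leNgt.
  apply: le_trans _ l2; rewrite -[leRHS]expr1 ler_weXn2l// ?ler1n//.
case: n n2 ln n_min => // n n1 ln n_min.
have n_le : 2 ^+ n <= lambda.
  by rewrite leNgt; apply/negP => /n_min; rewrite ltnn.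
have four : 4 <= 2 ^+ n.+1 :> R.
  by rewrite -natrX ler_nat (@leq_exp2l 2 2).
have lr : lambda * r < lambda / 6 by rewrite ltr_pM2l; lra.
rewrite exprS ler_wpM2l// andbT; rewrite exprS in ln four.
by have [?|?] := lerP 3 lambda; lra.
Qed.

Lemma natX_le_powR (R : realType) (D n : nat) (lambda : R) :
  (0 < D)%N -> 0 < lambda -> 2 ^+ n <= 2 * lambda ->
  (D ^ n)%:R <= D%:R * lambda `^ (ln D%:R / ln 2).
Proof.
move=> D0 l0 n_le.
have D1 : 1 <= D%:R :> R by rewrite ler1n.
have Dp : 0 < D%:R :> R by rewrite ltr0n.
have ln2 : 0 < ln 2 :> R by rewrite ln_gt0// ltr1n.
have : n%:R * ln 2 <= ln 2 + ln lambda.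
  rewrite -lnM ?posrE// mulr_natl -lnXn//.
  by rewrite ler_ln ?posrE ?exprn_gt0 ?mulr_gt0.
move=> n_log; rewrite /powR gt_eqF//.
rewrite -[X in X * _](@lnK _ D%:R) ?posrE// -expRD natrX.
rewrite -[X in X ^+ _](@lnK _ D%:R) ?posrE// -expRM_natl ler_expR.
have -> : n%:R * ln D%:R = (n%:R * ln 2) * (ln D%:R / ln 2) :> R.
  by field; rewrite gt_eqF.
have -> : ln D%:R + ln D%:R / ln 2 * ln lambda =
    (ln 2 + ln lambda) * (ln D%:R / ln 2).
  by field; rewrite gt_eqF.
by rewrite ler_wpM2r// divr_ge0 ?ln_ge0 ?ler1n.
Qed.

(** [1 <= lambda / 2] and [2 * lambda * r <= lambda / 3]. *)
Lemma parent_radius (R : realFieldType) (lambda r : R) :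
  2 <= lambda -> r < 1 / 6 -> 1 + 2 * (lambda * r) <= lambda.
Proof.
move=> l2 r6; have lr : lambda * r < lambda / 6 by rewrite ltr_pM2l; lra.
lra.
Qed.

(** * Hyperbolic approximations *)

Lemma mdist_lt_of_elog (R : realType) (M : metricType R) (r : R) (k : nat)
    (p q : M) :
  0 < r -> r < 1 -> (elog (1 / r) (diam M) < k%:R%:E)%E ->
  mdist p q < r ^ (- k%:Z).
Proof.
move=> r0 r1 diam_lt.
have rk0 : 0 < r ^ (- k%:Z) by rewrite exprz_gt0.
have := mdist_ge0 p q; rewrite le_eqVlt => /predU1P[<-//|pq0].
have pq_diam : ((mdist p q)%:E <= diam M)%E.
  by apply: ereal_sup_ubound; exists (p, q).
have lnr : 0 < ln (1 / r) by rewrite ln_gt0// ltr_pdivlMr// mul1r.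
have : (elog (1 / r) (mdist p q)%:E < k%:R%:E)%E.
  apply: le_lt_trans diam_lt; rewrite /elog lee_wpmul2r//.
    by rewrite lee_fin invr_ge0 ltW.
  have pos (x : \bar R) : ((mdist p q)%:E <= x)%E -> x \in `[0%E, +oo%E].
    by move=> /(le_trans _) xpos; rewrite in_itv/= leey andbT xpos// lee_fin ltW.
  by rewrite lee_lne// pos.
rewrite /elog lne_EFin// -EFinM lte_fin ltr_pdivrMr// mulr_natl.
rewrite -lnXn ?divr_gt0// ltr_ln ?posrE ?exprn_gt0 ?divr_gt0//.
by rewrite div1r exprVn -exprnN.
Qed.

Section Approximation.
Variables (R : realType) (M : metricType R) (D : nat) (lambda r : R).
Variables (L : int -> set M) (k : nat).
Hypotheses (lambda_ge2 : 2 <= lambda) (r_gt0 : 0 < r) (r_lt : r < 1 / 6).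
Hypotheses (M_compact : compact [set: M]).
Hypothesis L_net : forall i : int, is_net (r ^ i) (L i).

Local Notation V := (Gvertex L k).
Implicit Types u v w : V.

Let lambda_gt0 : 0 < lambda. Proof. exact: lt_le_trans lambda_ge2. Qed.

Let r_lt1 : r < 1.
Proof. by apply: lt_trans r_lt _; rewrite ltr_pdivrMr ?mul1r ?ltr1n. Qed.

Let lambda_r_gt0 : 0 < 1 + lambda * r.
Proof. by rewrite addr_gt0 ?mulr_gt0. Qed.

Lemma vertexP v : Gverts L k (val v).
Proof.
have fin := finite_Gverts k r_gt0 M_compact L_net.
by have := valP v; rewrite in_fset_set// => /set_mem.
Qed.

Lemma exists_vertex (i : int) (p : M) :
  - k%:Z <= i <= k%:Z -> L i p -> exists v, val v = (i, p).
Proof.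
move=> ik Lp; have fin := finite_Gverts k r_gt0 M_compact L_net.
have v_in : (i, p) \in fset_set (Gverts L k) by rewrite in_fset_set// inE.
by exists [` v_in]%fset.
Qed.

Lemma vertex_separated u v : (val u).1 = (val v).1 -> u != v ->
  r ^ (val u).1 <= mdist (val u).2 (val v).2.
Proof.
move=> uv1 uv; have [_ Lu] := vertexP u; have [_ Lv] := vertexP v.
apply: (L_net (val u).1).1 => //; first by rewrite uv1.
move=> uv2; case/eqP: uv; apply: val_inj.
by rewrite [LHS]surjective_pairing [RHS]surjective_pairing uv1 uv2.
Qed.

Definition height v : nat := absz ((val v).1 + k%:Z).

Lemma heightE v : (height v)%:Z = (val v).1 + k%:Z.
Proof.
have [/andP[+ _] _] := vertexP v; rewrite -subr_ge0 opprK => h0.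
by rewrite /height gez0_abs.
Qed.

(** Parents are the net points of the next coarser layer within this distance,
    rather than all radial neighbours.  The radius is just large
    enough for horizontal neighbours to share a parent, and small enough for the
    number of parents to be bounded by [D * lambda ^ (log_2 D)]. *)
Definition parents v : {set V} :=
  [set w | `[< (val v).1 = (val w).1 + 1 /\
    mdist (val v).2 (val w).2 <= (1 + lambda * r) * r ^ (val w).1 >]].

Definition close u v : Prop := (val u).1 = (val v).1 /\
  layer_ball lambda r (val u) `&` layer_ball lambda r (val v) !=set0.

Lemma parentsP v w : reflect ((val v).1 = (val w).1 + 1 /\
    mdist (val v).2 (val w).2 <= (1 + lambda * r) * r ^ (val w).1)
  (w \in parents v).
Proof. by rewrite inE; apply: asboolP. Qed.

Lemma height_parents v w : w \in parents v -> height v = (height w).+1.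
Proof.
move=> /parentsP[vw _]; apply/eqP; rewrite -eqz_nat.
by rewrite -addn1 PoszD !heightE vw addrAC.
Qed.

Lemma parents_radial v w : w \in parents v ->
  radial lambda r (val w) (val v).
Proof.
move=> /parentsP[vw vw_le]; split=> // z; rewrite /layer_ball /cball /= => zv.
apply: le_trans (metric_triangle z (val v).2 (val w).2) _.
apply: le_trans (lerD zv vw_le) _.
rewrite vw expfzDr ?gt_eqF// expr1z.
set s := r ^ (val w).1; have s0 : 0 < s by rewrite exprz_gt0.
have -> : lambda * (s * r) + (1 + lambda * r) * s = (1 + 2 * (lambda * r)) * s.
  by ring.
by rewrite ler_wpM2r// ?parent_radius// ltW.
Qed.

Lemma layer_ball_center (x : int * M) : layer_ball lambda r x x.2.
Proof.
by rewrite /layer_ball /cball /= mdistxx mulr_ge0// ltW// exprz_gt0.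
Qed.

Lemma close_parents u v w z :
  close u v -> w \in parents u -> z \in parents v -> close w z.
Proof.
move=> [uv [p [pu pv]]] wu zv; split.
  have /parentsP[wu1 _] := wu; have /parentsP[zv1 _] := zv.
  by apply: (@addIr _ 1); rewrite -wu1 -zv1.
exists p; split; first exact: (parents_radial wu).2.
exact: (parents_radial zv).2.
Qed.

Lemma Gedge_sym : symmetric (@Gedge R M lambda r L k).
Proof.
move=> u v; apply/asboolP/asboolP => -[[uv uv2 uvI]|uv|uv];
  (try by constructor 2); (try by constructor 3); constructor 1.
  by split=> //; [exact: nesym|rewrite setIC].
by split=> //; [exact: nesym|rewrite setIC].
Qed.

Variable o : V.
Hypothesis o_top : (val o).1 = - k%:Z.

Lemma height_base : height o = 0%N.
Proof. by rewrite /height o_top addNr. Qed.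

Lemma radial_neq_base u v : radial lambda r (val u) (val v) -> v != o.
Proof.
move=> [vu _]; apply/eqP => vo; have [/andP[ku _] _] := vertexP u.
by move: ku; rewrite -ltzD1 -vu vo o_top ltxx.
Qed.

Lemma Gedge_close u v : Gedge lambda r u v ->
  [\/ close u v, v != o /\ (forall w, w \in parents v -> close w u)
    | u != o /\ (forall w, w \in parents u -> close w v)].
Proof.
have down x y : radial lambda r (val x) (val y) ->
    y != o /\ (forall w, w \in parents y -> close w x).
  move=> xy; split=> [|w /[dup] wy /parentsP[yw _]].
    exact: radial_neq_base xy.
  case: xy => yx yx_ball; split; first by apply: (@addIr _ 1); rewrite -yx -yw.
  exists (val y).2; split; last exact/yx_ball/layer_ball_center.
  exact/(parents_radial wy).2/layer_ball_center.
move=> /asboolP[[uv1 _ uvI]|/down|/down]; by [constructor 1|constructor 2|constructor 3].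
Qed.

Hypothesis diam_lt : (elog (1 / r) (diam M) < k%:R%:E)%E.

Lemma height_eq0 v : height v = 0%N -> v = o.
Proof.
move=> hv; have v_top : (val v).1 = - k%:Z.
  by apply/eqP; rewrite -subr_eq0 opprK -heightE hv.
apply/eqP; apply/negPn/negP => vo.
have := vertex_separated _ vo; rewrite v_top o_top => /(_ erefl).
by apply/negP; rewrite -ltNge mdist_lt_of_elog.
Qed.

Lemma parent_vertex v (p : M) : v != o -> L ((val v).1 - 1) p ->
  exists w, val w = ((val v).1 - 1, p).
Proof.
move=> vo Lp; apply: exists_vertex Lp; have [/andP[kv vk] _] := vertexP v.
rewrite (le_trans _ vk) ?gerDl// andbT lerBrDr lezD1 lt_neqAle kv andbT.
apply: contra_neq vo => vk0; apply: height_eq0; apply/eqP.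
by rewrite -eqz_nat heightE -vk0 addNr.
Qed.

(** A net point within [r ^ (i - 1)] of a common point of the two balls lies
    within [r ^ (i - 1) + lambda * r ^ i] of both centres. *)
Lemma close_common_parent u v : u != o -> v != o -> close u v ->
  exists w, w \in parents u /\ w \in parents v.
Proof.
move=> uo vo [uv [p [pu pv]]].
have [q Lq pq] := (L_net ((val u).1 - 1)).2 p.
have [w wE] := parent_vertex uo Lq.
have common x : (val x).1 = (val u).1 -> layer_ball lambda r (val x) p ->
    w \in parents x.
  move=> xu px; apply/parentsP; rewrite wE/= subrK; split=> //.
  apply: le_trans (metric_triangle (val x).2 p q) _.
  rewrite mulrDl mul1r addrC lerD//.
  rewrite metric_sym (le_trans px)// xu -mulrA -{2}[r]expr1z -expfzDr ?gt_eqF//.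
  by rewrite addrC subrK.
by exists w; split; apply: common.
Qed.

Lemma parents_nonempty v : v != o -> exists w, w \in parents v.
Proof.
move=> vo; have vv : close v v.
  by split=> //; exists (val v).2; split; exact: layer_ball_center.
by have [w [wv _]] := close_common_parent vo vo vv; exists w.
Qed.

Lemma card_parents v n : doubling M D ->
  2 * (1 + lambda * r) < 2 ^+ n -> (#|parents v| <= D ^ n)%N.
Proof.
move=> dD n_gt; set s := r ^ ((val v).1 - 1).
have s0 : 0 < s by rewrite exprz_gt0.
have layer w : w \in parents v -> (val w).1 = (val v).1 - 1.
  by move=> /parentsP[-> _]; rewrite addrK.
apply: (@doubling_packing R M D dD (val v).2 ((1 + lambda * r) * s) s n _ _
  (fun w => (val w).2)).
- exact: mulr_gt0.
- by rewrite ltr_pdivrMr ?exprn_gt0// mulrA mulrC ltr_pM2l.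
- move=> w /[dup] /layer wE /parentsP[_]; rewrite metric_sym wE; exact.
- move=> t u tv uv tu; rewrite /s -(layer t tv); apply: vertex_separated => //.
  by rewrite (layer t tv) (layer u uv).
Qed.

End Approximation.

Theorem theorem4p7 (R : realType) (M : metricType R) (D : nat) (lambda r : R)
    (L : int -> set M) (k : nat) (o : Gvertex L k) :
  2 <= lambda -> 0 < r -> r < 1 / 6 ->
  compact [set: M] -> (0 < D)%N -> doubling M D ->
  (forall i : int, is_net (r ^ i) (L i)) ->
  (elog (1 / r) (diam M) < k%:R%:E)%E ->
  (val o).1 = - k%:Z ->
  let dist : Gvertex L k -> Gvertex L k -> R :=
    graph_dist R (@Gedge R M lambda r L k) in
  d1 dist o <= sd1 dist o /\
  sd1 dist o <= 1 + 2 * D%:R * lambda `^ (ln D%:R / ln 2).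
Proof.
move=> lambda_ge2 r_gt0 r_lt M_compact D_gt0 M_doubling L_net diam_lt o_top dist.
have [n /andP[n_gt n_le]] := halving_number lambda_ge2 r_gt0 r_lt.
have [] := @layered_graph_sd1 R (Gvertex L k) o (@Gedge R M lambda r L k)
  (@height R M L k) (@parents R M lambda r L k) (@close R M lambda r L k) (D ^ n).
- exact: Gedge_sym.
- exact: height_base.
- exact: (height_eq0 r_gt0 r_lt M_compact L_net o_top diam_lt).
- exact: parents_nonempty.
- by move=> x _; apply: card_parents.
- move=> x w _ /(parents_radial lambda_ge2 r_gt0 r_lt) wx.
  by apply/asboolP; constructor 3.
- by move=> x w _; exact: height_parents.
- by move=> x y [xy _]; rewrite /height xy.
- exact: close_common_parent.
- by move=> x y w v _ _; exact: close_parents.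
- exact: Gedge_close.
move=> d1_le sd1_le; split=> //; apply: le_trans sd1_le _.
rewrite lerD2l -mulrA ler_wpM2l//; apply: natX_le_powR => //.
exact: lt_le_trans lambda_ge2.
Qed.
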